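(* (a) For every $n\ge 1$, \[ \sigma(n)+\sigma_o(n)+2\sum_{k=1}^{n-1}(-1)^k\delta_s(k)\bigl(\sigma(n-k)+\sigma_o(n-k)\bigr)=2(-1)^{n+1}n\,\delta_s(n). \] (b) For every $n\ge 1$, \[ \sum_{k=1}^{n}\bigl(\sigma_o(k)-\sigma_e(k)\bigr)\delta_t(n-k)=n\,\delta_t(n). \] (c) For every $n\ge 2$, \[ \sigma(n)+\sigma_s(n)+2\sum_{k=1}^{n-1}(-1)^k\delta_s(k)\bigl(\sigma(n-k)+\sigma_s(n-k)\bigr)=2(-1)^{n+1}n\,\delta_s(n). \]
   Context: $\sigma(n)$ is the sum of the positive divisors of $n$, $\sigma_o(n)$ the sum of the odd positive divisors of $n$, $\sigma_e(n)$ the sum of the even positive divisors of $n$, and $\sigma_s(n)=\sum_{d\mid n}(-1)^{d-1}\frac{n}{d}$. For $n\ge1$, $\delta_s(n)=1$ if $n$ is a perfect square and $0$ otherwise. For $n\ge0$, $\delta_t(n)=1$ if $n=\frac{m(m+1)}{2}$ for some integer $m\ge0$ (so $\delta_t(0)=1$), and $0$ otherwise. *)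

(* Defs.v *)
From mathcomp Require Import all_boot all_order all_algebra.
Set Implicit Arguments. Unset Strict Implicit. Unset Printing Implicit Defensive.
Import Order.TTheory GRing.Theory Num.Theory.

Definition sigma (n : nat) : nat := \sum_(d <- divisors n) d.
Definition sigma_o (n : nat) : nat := \sum_(d <- divisors n | odd d) d.
Definition sigma_e (n : nat) : nat := \sum_(d <- divisors n | ~~ odd d) d.
Definition sigma_s (n : nat) : int :=
  (\sum_(d <- divisors n) (-1) ^+ (d - 1) * (n %/ d)%:Z)%R.
Definition delta_s (n : nat) : nat := [exists m : 'I_n.+1, m * m == n].
Definition delta_t (n : nat) : nat := [exists m : 'I_n.+1, (m * m.+1) %/ 2 == n].

(* Main.v *)
Require Import Defs.
From mathcomp Require Import all_boot all_order all_algebra.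
From mathcomp Require Import zify ring.
Set Implicit Arguments.
Unset Strict Implicit.
Unset Printing Implicit Defensive.
Import Order.TTheory GRing.Theory Num.Theory.
Local Open Scope ring_scope.

(** The proof is in the style of Liouville.  For N > 0 let G(N) be the sum of
    (-1)^d d over the triples (x, d, e) with x in Z, d, e >= 1,
    x^2 + 4 d e = N and x + e odd.  Since x -> -x is a symmetry, 2 G(N) is the
    sum of (-1)^d (2 d - x).  The map (x, d, e) -> (-x - 2 e, d - x - e, e)
    preserves 2 d - x and the quadratic form and flips the parity of d, so the
    triples with d - e - x > 0 cancel.  The map (x, d, e) -> (2 d - x, d, e - d + x)
    turns those with d - e - x < 0 into a sum of (-1)^d x on which the symmetry
    (x, d, e) -> (-x, e, d) exchanges the signs of d - e - x.  Only triples with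
    x = d - e, i.e. N = (d + e)^2, survive: G(N) is -N/4 if N is an even square,
    -(N-1)/4 if N is an odd square, and 0 otherwise.  Summing over d and e for
    fixed x, N = 4 n gives (a) and N = 8 n + 1 gives (b).  Finally (c) is (a),
    because sigma_s = sigma_o. *)

(** * Reindexing finite sums by mutually inverse maps *)

Lemma big_seq_reindex (R : Type) (idx : R) (op : Monoid.com_law idx)
    (I J : eqType) (r : seq I) (s : seq J) (P : pred I) (Q : pred J)
    (f : I -> J) (g : J -> I) (F : J -> R) :
  uniq r -> uniq s ->
  (forall i, i \in r -> P i -> [/\ f i \in s, Q (f i) & g (f i) = i]) ->
  (forall j, j \in s -> Q j -> [/\ g j \in r, P (g j) & f (g j) = j]) ->
  \big[op/idx]_(j <- s | Q j) F j = \big[op/idx]_(i <- r | P i) F (f i).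
Proof.
move=> Ur Us fP gP.
rewrite -big_filter -[RHS]big_filter -(big_map f xpredT F).
apply/perm_big/uniq_perm => [||j].
- exact: filter_uniq.
- rewrite map_inj_in_uniq ?filter_uniq // => i1 i2.
  rewrite !mem_filter => /andP[P1 r1] /andP[P2 r2] e.
  by have [_ _ <-] := fP _ r1 P1; have [_ _ <-] := fP _ r2 P2; rewrite e.
apply/idP/mapP => [|[i]]; rewrite mem_filter => /andP[].
  by move=> Qj sj; have [rg Pg fg] := gP _ sj Qj; exists (g j); rewrite ?mem_filter ?Pg.
by move=> Pi ri ->; have [sf Qf _] := fP _ ri Pi; rewrite mem_filter Qf.
Qed.

(** * Finite boxes of integer triples *)

Definition posz_range (B : nat) : seq int := [seq Posz i | i <- index_iota 1 B.+1].
(** The negative half starts at 1 so that 0 is listed only once. *)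
Definition int_range (B : nat) : seq int :=
  [seq Posz i | i <- index_iota 0 B.+1] ++ [seq - Posz i | i <- index_iota 1 B.+1].
Definition box (B : nat) : seq (int * (int * int)) :=
  [seq (x, p) | x <- int_range B,
     p <- [seq (d, e) | d <- posz_range B, e <- posz_range B]].

Lemma mem_posz_range B z : (z \in posz_range B) = (0 < z <= B%:Z).
Proof.
apply/mapP/idP => [[i]|]; first by rewrite mem_index_iota => ? ->; lia.
by move=> ?; exists `|z|%N; rewrite ?mem_index_iota; lia.
Qed.

Lemma mem_int_range B z : (z \in int_range B) = (- B%:Z <= z <= B%:Z).
Proof.
rewrite mem_cat; apply/orP/idP => [[]/mapP[i]|zB].
- by rewrite mem_index_iota => ? ->; lia.
- by rewrite mem_index_iota => ? ->; lia.
case: (lerP 0 z) => ?; [left|right]; apply/mapP; exists `|z|%N;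
  rewrite ?mem_index_iota; lia.
Qed.

Lemma uniq_posz_range B : uniq (posz_range B).
Proof. by rewrite map_inj_uniq ?iota_uniq // => i j []. Qed.

Lemma uniq_int_range B : uniq (int_range B).
Proof.
rewrite cat_uniq !map_inj_uniq ?iota_uniq ?andbT //; first last.
- by move=> i j; lia.
- by move=> i j; lia.
apply/hasPn => z /mapP[i]; rewrite mem_index_iota => ? ->.
apply/mapP => -[j]; rewrite mem_index_iota; lia.
Qed.

Lemma uniq_box B : uniq (box B).
Proof.
do 2?[apply: allpairs_uniq => //; rewrite ?uniq_int_range ?uniq_posz_range //].
all: by move=> [? ?] [? ?] _ _ [-> ->].
Qed.

Lemma mem_box B x d e :
  ((x, (d, e)) \in box B) =
    [&& - B%:Z <= x <= B%:Z, 0 < d <= B%:Z & 0 < e <= B%:Z].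
Proof.
rewrite -mem_int_range -!mem_posz_range.
apply/allpairsP/and3P => [[[y p]] /= [xy /allpairsP[[d' e'] /= [? ? ->]]] [-> -> ->]|] //.
move=> [? ? ?]; exists (x, (d, e)); split=> //=.
by apply/allpairsP; exists (d, e).
Qed.

(** * Solutions of [x^2 + 4 d e = N] and their weights *)

Definition rep (N : nat) (t : int * (int * int)) : bool :=
  let: (x, (d, e)) := t in [&& 0 < d, 0 < e & x ^+ 2 + 4 * d * e == N%:Z].

Lemma rep_box N B t : (N <= B)%N -> rep N t -> t \in box B.
Proof.
case: t => [x [d e]] NB /and3P[d0 e0 /eqP E]; rewrite mem_box d0 e0 /=.
have de : 0 < d * e by rewrite mulr_gt0.
have dde : d <= d * e by rewrite ler_peMr //; lia.
have ede : e <= d * e by rewrite ler_peMl //; lia.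
have xx : `|x| <= x ^+ 2 by nia.
have -> : d <= B%:Z by lia.
have -> : e <= B%:Z by lia.
lia.
Qed.

(** The absolute value gives a natural exponent and keeps the parity of [z]. *)
Definition parity_sign (z : int) : int := (-1) ^+ `|z|%N.

Lemma parity_sign_odd (a b : int) : odd (absz (a + b)%R) -> parity_sign a = - parity_sign b.
Proof.
move=> h; rewrite /parity_sign -signr_odd -[in RHS]signr_odd.
have -> : odd `|a| = ~~ odd `|b| by lia.
by case: (odd _).
Qed.

Definition odd_xe (t : int * (int * int)) : bool :=
  let: (x, (d, e)) := t in odd (absz (x + e)%R).
Definition odd_de (t : int * (int * int)) : bool :=
  let: (x, (d, e)) := t in odd (absz (d + e)%R).
(** The involution of [rep_sum_cancel] exchanges [d] with the gap, and that of [rep_sum_flip]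
    exchanges [e] with minus the gap. The sign of the gap thus decides which of the two keeps [d]
    and [e] positive. *)
Definition gap (t : int * (int * int)) : int :=
  let: (x, (d, e)) := t in d - e - x.
Definition signed_d (t : int * (int * int)) : int :=
  let: (x, (d, e)) := t in parity_sign d * d.
Definition signed_x (t : int * (int * int)) : int :=
  let: (x, (d, e)) := t in parity_sign d * x.

(* The bound B only makes the sum finite: for N <= B every solution lies in the box. *)
Definition rep_sum (N B : nat) (P : pred (int * (int * int)))
    (F : int * (int * int) -> int) : int :=
  \sum_(t <- box B | rep N t && P t) F t.

(** * Liouville involutions on the solutions *)

Section RepSum.
Variables (N B : nat).
Hypothesis NB : (N <= B)%N.
Implicit Types (t : int * (int * int)) (P : pred (int * (int * int)))
  (F : int * (int * int) -> int).
Local Notation S := (rep_sum N B).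

(** Every map applied below is its own inverse on the selected triples, so [f] serves in both
    directions. Images stay in the box because they are solutions and [N <= B]. *)
Lemma rep_reindex (P Q : pred (int * (int * int))) f (F : _ -> int) :
  (forall t, rep N t -> P t -> [/\ rep N (f t), Q (f t) & f (f t) = t]) ->
  (forall t, rep N t -> Q t -> [/\ rep N (f t), P (f t) & f (f t) = t]) ->
  S Q F = S P (F \o f).
Proof.
move=> h1 h2; apply: (@big_seq_reindex _ _ _ _ _ _ _ _ _ f f); rewrite ?uniq_box //.
  move=> t _ /andP[rt Pt]; have [r q ->] := h1 t rt Pt.
  by rewrite r q (rep_box NB r).
move=> t _ /andP[rt Pt]; have [r q ->] := h2 t rt Pt.
by rewrite r q (rep_box NB r).
Qed.
Arguments rep_reindex : clear implicits.

Lemma eq_rep_sum P F1 F2 :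
  (forall t, rep N t -> P t -> F1 t = F2 t) -> S P F1 = S P F2.
Proof. by move=> eF; apply: eq_bigr => t /andP[]; apply: eF. Qed.

Lemma rep_sumN P F : S P (fun t => - F t) = - S P F.
Proof. exact: sumrN. Qed.

(** Replacing [x] by [-x] keeps the sign given by [d] and negates [x], so the sum equals its own
    negative. *)
Lemma rep_sum_neg (P : pred (int * (int * int))) :
  (forall x d e : int, P (- x, (d, e)) = P (x, (d, e))) -> S P signed_x = 0.
Proof.
move=> Pneg.
suff : S P signed_x = - S P signed_x by lia.
rewrite {1}(rep_reindex P P (fun t => (- t.1, t.2))).
- by rewrite -rep_sumN; apply: eq_rep_sum => -[x [d e]] _ _; rewrite /signed_x /= mulrN.
- by move=> [x [d e]] /=; rewrite Pneg sqrrN opprK.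
- by move=> [x [d e]] /=; rewrite Pneg sqrrN opprK.
Qed.

Lemma rep_sum_cancel :
  S (fun t => odd_xe t && (0 < gap t)) (fun t => 2 * signed_d t - signed_x t) = 0.
Proof.
set X := LHS; suff : X = - X by lia.
pose f t : int * (int * int) := let: (x, (d, e)) := t in (- x - 2 * e, (d - x - e, e)).
have fP t : rep N t -> odd_xe t && (0 < gap t) ->
  [/\ rep N (f t), odd_xe (f t) && (0 < gap (f t)) & f (f t) = t].
  case: t => [x [d e]] /and3P[d0 e0 /eqP E] /andP[/= p c0]; split.
  - apply/and3P; split; [lia|lia|apply/eqP; rewrite -E; ring].
  - by apply/andP; split; lia.
  - by congr (_, (_, _)); ring.
rewrite {1}/X (rep_reindex _ _ f _ fP fP) /X -rep_sumN.
apply: eq_rep_sum => -[x [d e]] _ /andP[/= p _].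
rewrite (@parity_sign_odd (d - x - e) d); [ring|lia].
Qed.

Lemma rep_sum_flip :
  S (fun t => odd_xe t && (gap t < 0)) (fun t => 2 * signed_d t - signed_x t) =
  S (fun t => odd_de t && (gap t < 0)) signed_x.
Proof.
(* The new [x] is the factor [2 d - x] of the weight, and the new [d + e] is the old [x + e]; hence
   [odd_xe] turns into [odd_de]. *)
pose f t : int * (int * int) := let: (x, (d, e)) := t in (2 * d - x, (d, e - d + x)).
rewrite [RHS](rep_reindex (fun t => odd_xe t && (gap t < 0)) _ f).
- by apply: eq_rep_sum => -[x [d e]] _ _ /=; ring.
- move=> [x [d e]] /and3P[d0 e0 /eqP E] /andP[/= p c0]; split.
  + apply/and3P; split; [lia|lia|apply/eqP; rewrite -E; ring].
  + by apply/andP; split; lia.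
  + by congr (_, (_, _)); ring.
- move=> [x [d e]] /and3P[d0 e0 /eqP E] /andP[/= p c0]; split.
  + apply/and3P; split; [lia|lia|apply/eqP; rewrite -E; ring].
  + by apply/andP; split; lia.
  + by congr (_, (_, _)); ring.
Qed.

Lemma rep_sum_swap :
  S (fun t => odd_de t && (gap t < 0)) signed_x = S (fun t => odd_de t && (0 < gap t)) signed_x.
Proof.
pose f t : int * (int * int) := let: (x, (d, e)) := t in (- x, (e, d)).
rewrite [RHS](rep_reindex (fun t => odd_de t && (gap t < 0)) _ f).
- apply: eq_rep_sum => -[x [d e]] _ /andP[/= p _].
  (* Exchanging [d] and [e] flips the sign since [d + e] is odd; passing to [-x] flips it back. *)
  by rewrite (@parity_sign_odd d e) //; ring.
- move=> [x [d e]] /and3P[d0 e0 /eqP E] /andP[/= p c0]; split.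
  + apply/and3P; split; [lia|lia|apply/eqP; rewrite -E; ring].
  + by apply/andP; split; lia.
  + by congr (_, (_, _)); ring.
- move=> [x [d e]] /and3P[d0 e0 /eqP E] /andP[/= p c0]; split.
  + apply/and3P; split; [lia|lia|apply/eqP; rewrite -E; ring].
  + by apply/andP; split; lia.
  + by congr (_, (_, _)); ring.
Qed.

(** * Reduction to the diagonal [x = d - e] *)

Lemma rep_sum_trichotomy P F :
  S P F = S (fun t => P t && (0 < gap t)) F + S (fun t => P t && (gap t < 0)) F
          + S (fun t => P t && (gap t == 0)) F.
Proof.
rewrite /rep_sum (bigID (fun t => 0 < gap t)) /= -addrA; congr (_ + _).
  by apply: eq_bigl => t; rewrite andbA.
rewrite (bigID (fun t => gap t < 0)) /=; congr (_ + _).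
  by apply: eq_bigl => t; case: (rep N t) => //; case: (P t) => //=; lia.
by apply: eq_bigl => t; case: (rep N t) => //; case: (P t) => //=; lia.
Qed.

(** Let G be the sum on the left, D1 and D2 the diagonal sums on the right, and A the common value
    of the sums in [rep_sum_swap]. Splitting by the sign of the gap gives 2 G = A + D1 and 0 = 2 A +
    D2; the factor 4 clears the halves. *)
Lemma rep_sum_diag :
  4 * S odd_xe signed_d = 2 * S (fun t => odd_xe t && (gap t == 0))
                             (fun t => 2 * signed_d t - signed_x t)
  - S (fun t => odd_de t && (gap t == 0)) signed_x.
Proof.
have h1 : S odd_xe (fun t => 2 * signed_d t - signed_x t) = 2 * S odd_xe signed_d.
  rewrite /rep_sum sumrB -/(rep_sum N B odd_xe signed_x) rep_sum_neg ?subr0 ?mulr_sumr //.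
  by move=> x d e /=; lia.
have h2 := rep_sum_trichotomy odd_xe (fun t => 2 * signed_d t - signed_x t).
have h3 := rep_sum_trichotomy odd_de signed_x.
have h4 : S odd_de signed_x = 0 by apply: rep_sum_neg.
move: h1 h2 h3; rewrite h4 rep_sum_cancel rep_sum_flip rep_sum_swap; lia.
Qed.

(** On the diagonal the form equals [(d + e)^2], so [d + e = s] and [d] alone determines the
    triple. *)
Lemma rep_sum_square (s : nat) P F : N = (s * s)%N ->
  S (fun t => P t && (gap t == 0)) F =
  \sum_(1 <= d < s | P (2 * d%:Z - s%:Z, (d%:Z, s%:Z - d%:Z)))
     F (2 * d%:Z - s%:Z, (d%:Z, s%:Z - d%:Z)).
Proof.
move=> Ns; apply: (@big_seq_reindex _ _ _ _ _ _ _ _ _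
  (fun d : nat => (2 * d%:Z - s%:Z, (d%:Z, s%:Z - d%:Z))) (fun t => `|t.2.1|%N)).
- exact: iota_uniq.
- exact: uniq_box.
- move=> d; rewrite mem_index_iota => ds Pd.
  have r : rep N (2 * d%:Z - s%:Z, (d%:Z, s%:Z - d%:Z)).
    by apply/and3P; split; [lia|lia|rewrite Ns PoszM; apply/eqP; ring].
  by rewrite r Pd (rep_box NB r) //=; split=> //; apply/eqP; ring.
move=> [x [d e]] _ /andP[r /andP[Pt /eqP /= ct]].
have /and3P[d0 e0 /eqP E] := r.
have xE : x = d - e by lia.
have dE : d + e = s%:Z.
  have : (d + e) ^+ 2 = s%:Z ^+ 2.
    by rewrite [RHS]expr2 -PoszM -Ns -E xE; ring.
  by move/eqP; rewrite eqf_sqr; lia.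
have tE : (2 * `|d|%N%:Z - s%:Z, (`|d|%N%:Z, s%:Z - `|d|%N%:Z)) = (x, (d, e)).
  by congr (_, (_, _)); lia.
by rewrite mem_index_iota /= tE Pt; split=> //; lia.
Qed.

Lemma rep_sum_nonsquare P F : (forall s : nat, N <> (s * s)%N) ->
  S (fun t => P t && (gap t == 0)) F = 0.
Proof.
move=> Ns; apply: big1 => -[x [d e]] /andP[/and3P[d0 e0 /eqP E] /andP[_ /eqP /= ct]].
case: (Ns (absz (d + e)%R)); apply/eqP; rewrite -(eqr_nat int) natrM !natz -E.
have -> : x = d - e by lia.
by rewrite gtz0_abs; [apply/eqP; ring|lia].
Qed.

(** * Evaluation of the diagonal terms *)

Lemma sum_odd_const (s : nat) (a : int) :
  \sum_(1 <= d < s | odd d) a = a *+ s./2.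
Proof.
elim: s => [|s IH]; first by rewrite big_geq.
case: s IH => [|s] IH; first by rewrite big_geq.
rewrite big_mkcond big_nat_recr //= -big_mkcond IH /=.
case: ifP => os; last by rewrite addr0; congr (_ *+ _); lia.
by rewrite -mulrSr; congr (_ *+ _); lia.
Qed.

(** The terms for [d = 2 i - 1] and [d = 2 i] add up to 2, because [a] cancels. *)
Lemma alternating_sum (r : nat) (a : int) :
  \sum_(1 <= d < r.*2.+1) parity_sign d%:Z * (2 * d%:Z - a) = 2 * r%:Z.
Proof.
elim: r => [|r IH]; first by rewrite big_geq.
rewrite doubleS big_nat_recr //= big_nat_recr //= IH.
have -> : parity_sign r.*2.+1 = -1 by rewrite /parity_sign -signr_odd /= odd_double.
have -> : parity_sign r.*2.+2 = 1 by rewrite /parity_sign -signr_odd /= odd_double.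
lia.
Qed.

(** On the diagonal [x + e = d], [d + e = s] and [2 d - x = s]. So the first sum of [rep_sum_diag]
    runs over odd [d] with constant term [-s], and the second is empty unless [s] is odd. *)
Lemma rep_sum_square_diag s : N = (s * s)%N ->
  4 * S odd_xe signed_d = - 2 * (s%:Z *+ s./2)
    - \sum_(1 <= d < s | odd s) parity_sign d%:Z * (2 * d%:Z - s%:Z).
Proof.
move=> Ns; rewrite rep_sum_diag !(@rep_sum_square s) //; congr (_ - _).
  rewrite mulNr -mulrN -mulNrn -sum_odd_const; congr (_ * _).
  apply: eq_big => d /=; first by congr odd; lia.
  move=> od; have -> : parity_sign d%:Z = -1.
    by rewrite /parity_sign -signr_odd /=; have -> : odd d by lia.
  by ring.
by apply: eq_bigl => d /=; congr odd; lia.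
Qed.

Lemma rep_sum_even_square r : N = (r.*2 * r.*2)%N ->
  S odd_xe signed_d = - (r * r)%N%:Z.
Proof.
move=> Nr; have := rep_sum_square_diag Nr.
rewrite odd_double big_pred0 // doubleK -mulr_natr natz; lia.
Qed.

Lemma rep_sum_odd_square r : N = (r.*2.+1 * r.*2.+1)%N ->
  S odd_xe signed_d = - (r * r.+1)%N%:Z.
Proof.
move=> Nr; have := rep_sum_square_diag Nr.
rewrite /= odd_double /= alternating_sum uphalf_double -mulr_natr natz; lia.
Qed.

Lemma rep_sum_eq0 : (forall s : nat, N <> (s * s)%N) -> S odd_xe signed_d = 0.
Proof. by move=> Ns; have := rep_sum_diag; rewrite !rep_sum_nonsquare //; lia. Qed.

(** * Slicing the solutions by [x] *)

Definition slice (x : nat) : int :=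
  \sum_(1 <= d < B.+1) \sum_(1 <= e < B.+1 | (x * x + 4 * d * e == N)%N && odd (x + e))
    (-1) ^+ d * d%:Z.

(** The conditions depend on [x] only through [x^2] and its parity, so [x] and [-x] contribute
    equally, and 0 contributes once. *)
Lemma rep_sum_slice :
  S odd_xe signed_d = slice 0 + 2 * \sum_(1 <= x < B.+1) slice x.
Proof.
rewrite /rep_sum big_mkcond /= big_allpairs.
have E (z : int) (x : nat) : `|z|%N = x ->
  \sum_(p <- [seq (d, e) | d <- posz_range B, e <- posz_range B])
     (if rep N (z, p) && odd_xe (z, p) then signed_d (z, p) else 0) = slice x.
  move=> zx; rewrite big_allpairs big_map; apply: eq_big_nat => d /andP[d0 _].
  rewrite big_map [RHS]big_mkcond; apply: eq_big_nat => e /andP[e0 _] /=.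
  congr (if _ then _ else _).
  have -> : z ^+ 2 = (x * x)%N%:Z by rewrite -zx; lia.
  lia.
rewrite big_cat !big_map /= big_ltn // (E _ 0%N) //.
under eq_big_nat => x _ do rewrite (E _ x) //.
under [X in _ + X]eq_big_nat => x _ do rewrite (E _ x) ?abszN //.
by rewrite mulr2n mulrDl !mul1r addrA.
Qed.

End RepSum.

(** * Divisor sums restricted by the parity of the cofactor *)

Lemma big_divisors (B m : nat) (P : pred nat) (F : nat -> int) : (0 < m <= B)%N ->
  \sum_(d <- divisors m | P d) F d = \sum_(1 <= d < B.+1 | (d %| m)%N && P d) F d.
Proof.
case/andP=> m0 mB; rewrite -big_filter -[RHS]big_filter; apply/perm_big/uniq_perm.
- by rewrite filter_uniq // divisors_uniq.
- by rewrite filter_uniq // iota_uniq.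
move=> d; rewrite !mem_filter -dvdn_divisors // mem_index_iota.
case: (boolP (d %| m)%N) => [dm|]; last by rewrite andbF.
by have := dvdn_leq m0 dm; have := dvdn_gt0 m0 dm; case: (P d) => //=; lia.
Qed.

(** If [d] divides [m], the only candidate for [e] is [m %/ d], which is in range since [m <= B];
    otherwise there is none. *)
Lemma sum_factorizations (B m : nat) (P : pred nat) (F : nat -> int) :
  (0 < m <= B)%N ->
  \sum_(1 <= d < B.+1) \sum_(1 <= e < B.+1 | (d * e == m)%N && P e) F d =
  \sum_(d <- divisors m | P (m %/ d)%N) F d.
Proof.
move=> mB; rewrite (big_divisors _ _ mB) [RHS]big_mkcond.
apply: eq_big_nat => d /andP[d0 _].
case: (boolP (d %| m)%N) => [dm|ndm] /=; last first.
  apply: big_pred0 => e; apply: contraNF ndm => /andP[/eqP <- _].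
  exact: dvdn_mulr.
rewrite (eq_bigl (fun e => P e && (e == m %/ d)%N)) => [|e].
  rewrite big_nat1_cond_eq; case: (P _); rewrite ?andbF ?andbT //.
  have := leq_div m d; have : (0 < m %/ d)%N by rewrite divn_gt0 // dvdn_leq //; lia.
  by case: ifP; lia.
by rewrite andbC; congr (_ && _); rewrite -{1}(divnK dm) mulnC eqn_pmul2r.
Qed.

(** For [m = 2^a u] with [u] odd, this is [2^a] times the divisor sum of [u]. *)
Definition sigma_odd_cofactor (m : nat) : int :=
  \sum_(d <- divisors m | odd (m %/ d)) d%:Z.
Definition sigma_even_cofactor (m : nat) : int :=
  \sum_(d <- divisors m | ~~ odd (m %/ d)) d%:Z.

(** Doubling is a bijection from the divisors with even cofactor onto the even divisors. *)
Lemma sigma_even_cofactorE m : (0 < m)%N -> 2 * sigma_even_cofactor m = (sigma_e m)%:Z.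
Proof.
move=> m0; rewrite /sigma_even_cofactor /sigma_e -natz natr_sum.
rewrite (@big_divisors m) ?m0 ?leqnn // (@big_divisors m) ?m0 ?leqnn //.
rewrite mulr_sumr.
rewrite [RHS](@big_seq_reindex _ _ _ _ _ (index_iota 1 m.+1) _
  (fun d => (d %| m)%N && ~~ odd (m %/ d)) _ double half) ?iota_uniq //.
- by apply: eq_bigr => d _; rewrite natz; lia.
- move=> d; rewrite mem_index_iota => /andP[d0 _] /andP[dm o].
  have d2m : (d.*2 %| m)%N.
    by rewrite -{1}(divnK dm) -muln2 mulnC dvdn_pmul2r // dvdn2.
  rewrite mem_index_iota d2m odd_double doubleK; split=> //.
  by have := dvdn_leq m0 d2m; lia.
move=> d; rewrite mem_index_iota => /andP[d0 _] /andP[dm o].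
have dE : d./2.*2 = d by lia.
have hm : (d./2 %| m)%N by apply: dvdn_trans dm; rewrite -[X in (_ %| X)%N]dE -muln2 dvdn_mulr.
rewrite mem_index_iota hm dE; split=> //; first by have := dvdn_leq m0 dm; lia.
(* With [m = k d], the cofactor of [d/2] is [2 k]. *)
case/dvdnP: dm => k ->; rewrite -{1}dE -muln2 mulnA mulnAC mulnK; last lia.
by rewrite oddM andbF.
Qed.

Lemma sigma_cofactor m : sigma_odd_cofactor m + sigma_even_cofactor m = (sigma m)%:Z.
Proof.
rewrite /sigma_odd_cofactor /sigma_even_cofactor /sigma -[RHS]natz natr_sum.
rewrite [RHS](bigID (fun d => odd (m %/ d))) /=.
by congr (_ + _); apply: eq_bigr => d _; rewrite natz.
Qed.

Lemma sigma_odd_even m : (sigma_o m + sigma_e m)%N = sigma m.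
Proof. by rewrite /sigma (bigID odd). Qed.

Lemma sigma_odd_cofactorE m : (0 < m)%N ->
  2 * sigma_odd_cofactor m = (sigma m)%:Z + (sigma_o m)%:Z.
Proof.
move=> m0; have := sigma_even_cofactorE m0; have := sigma_odd_even m.
by have := sigma_cofactor m; lia.
Qed.

(** Exchanging [d] and [m %/ d] turns [sigma_s] into the odd-cofactor sum minus the even-cofactor
    sum, that is [sigma] minus twice the latter, hence [sigma - sigma_e]. *)
Lemma sigma_s_odd m : (0 < m)%N -> sigma_s m = (sigma_o m)%:Z.
Proof.
move=> m0; rewrite /sigma_s.
rewrite (@big_seq_reindex _ _ _ _ _ (divisors m) _ xpredT _
  (fun d => m %/ d)%N (fun d => m %/ d)%N) ?divisors_uniq //; last first.
- by move=> d; rewrite -!dvdn_divisors // => dm _; rewrite dvdn_div // divnA // mulKn.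
- by move=> d; rewrite -!dvdn_divisors // => dm _; rewrite dvdn_div // divnA // mulKn.
have signE d : (d %| m)%N ->
    (-1) ^+ (m %/ d - 1) = if odd (m %/ d) then 1 else -1 :> int.
  move=> dm; have d0 : (0 < d)%N := dvdn_gt0 m0 dm.
  have q0 : (0 < m %/ d)%N by rewrite divn_gt0 // dvdn_leq.
  move: (m %/ d)%N q0 => q q0; rewrite -signr_odd.
  by rewrite oddB //; case: (odd q).
transitivity (sigma_odd_cofactor m - sigma_even_cofactor m).
  rewrite (bigID (fun d => odd (m %/ d))) /=; congr (_ + _);
    rewrite /sigma_odd_cofactor /sigma_even_cofactor.
  - rewrite big_seq_cond [RHS]big_seq_cond; apply: eq_bigr => d.
    rewrite -dvdn_divisors // => /andP[dm o].
    by rewrite signE // divnA // mulKn // o mul1r.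
  - rewrite -[RHS]sumrN big_seq_cond [RHS]big_seq_cond; apply: eq_bigr => d.
    rewrite -dvdn_divisors // => /andP[dm o].
    by rewrite signE // divnA // mulKn // (negPf o) mulN1r.
have := sigma_even_cofactorE m0; have := sigma_odd_cofactorE m0.
by have := sigma_odd_even m; lia.
Qed.

(** * Sums over the values of an injective sequence *)

(** Since [j <= w j], a preimage of [k] is at most [k]: the bounded existential, which has the shape
    of [delta_s] and [delta_t], misses none. *)
Lemma sum_image (w : nat -> nat) (a b : nat) (F : nat -> int) :
  injective w -> (forall j, (j <= w j)%N) ->
  \sum_(a <= k < b | [exists m : 'I_k.+1, w m == k]) F k =
  \sum_(0 <= j < b | (a <= w j < b)%N) F (w j).
Proof.
move=> w_inj w_ge.
(* The inverse of [w] looks up [k] among the first [k + 1] values of [w]. *)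
have wK j : index (w j) (mkseq w (w j).+1) = j.
  rewrite /mkseq index_map //.
  have jE : nth 0%N (iota 0 (w j).+1) j = j by rewrite nth_iota ?ltnS.
  by rewrite -[X in index X _]jE index_uniq ?iota_uniq ?size_iota ?ltnS.
apply: (@big_seq_reindex _ _ _ _ _ _ _ _ _ w (fun k => index k (mkseq w k.+1)));
  rewrite ?iota_uniq //.
- move=> j; rewrite !mem_index_iota => _ wj; rewrite wj wK; split=> //.
  apply/existsP; have jw : (j < (w j).+1)%N by rewrite ltnS.
  by exists (Ordinal jw).
move=> k; rewrite !mem_index_iota => kab /existsP[m /eqP wm].
by rewrite -wm wK wm kab; split=> //; have := w_ge m; lia.
Qed.

(** * Squares: the case [N = 4 n] *)

Lemma slice_odd0 (n B x : nat) : odd x -> slice (4 * n) B x = 0.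
Proof.
move=> ox; apply: big1 => d _; apply: big_pred0 => e.
apply: contraTF ox => /andP[/eqP xE _].
have : odd (x * x) = false by lia.
by rewrite oddM andbb => ->.
Qed.

(** For [x = 2 j] the equation becomes [d e = n - j^2], and [x + e] is odd exactly when [e] is. An
    odd cofactor forces [d] to have the parity of [n + j], so the sign is constant. *)
Lemma slice_double (n B j : nat) : (4 * n <= B)%N ->
  slice (4 * n) B j.*2 =
  if (j * j < n)%N then (-1) ^+ (n + j) * sigma_odd_cofactor (n - j * j) else 0.
Proof.
move=> nB; case: ifPn => [jn|njn]; last first.
  rewrite /slice big_nat big1 // => d /andP[d0 _].
  rewrite big_nat_cond big_pred0 // => e.
  apply: contraNF njn => /andP[/andP[e0 _] /andP[/eqP E _]].
  have : (0 < d * e)%N by rewrite muln_gt0 d0.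
  by move: E; rewrite -!muln2; lia.
have mB : (0 < n - j * j <= B)%N by lia.
have m0 : (0 < n - j * j)%N by lia.
transitivity (\sum_(d <- divisors (n - j * j) | odd ((n - j * j) %/ d)) (-1) ^+ d * d%:Z).
  rewrite -(sum_factorizations _ _ mB); apply: eq_bigr => d _; apply: eq_bigl => e.
  rewrite oddD odd_double /= -!muln2; congr (_ && _); lia.
rewrite /sigma_odd_cofactor mulr_sumr big_seq_cond [RHS]big_seq_cond.
apply: eq_bigr => d; rewrite -dvdn_divisors // => /andP[dm o]; congr (_ * _).
have od : odd (n - j * j) = odd d by rewrite -[in LHS](divnK dm) oddM o.
have {}od : odd d = odd (n + j) by rewrite -od oddB 1?ltnW // oddM andbb oddD.
by rewrite -signr_odd od signr_odd.
Qed.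

(** A square root of [4 n] is even, so [4 n] is a square exactly when [n = r^2], and then the sum is
    [-r^2]. *)
Lemma rep_sum_delta_s n :
  rep_sum (4 * n) (4 * n) odd_xe signed_d = - (n%:Z * (delta_s n)%:Z).
Proof.
rewrite /delta_s; case: existsP => [[m /eqP mn]|nm].
  rewrite mulr1 (@rep_sum_even_square _ _ (leqnn _) m) ?mn //.
  by rewrite -!muln2; lia.
rewrite mulr0 oppr0 rep_sum_eq0 // => s sn; apply: nm.
have os : odd s = false by rewrite -[odd s]andbb -oddM -sn; lia.
have sE : s = s./2.*2 by lia.
move: sn; rewrite sE -muln2; move: (s./2) => r sn.
have rn : (r * r = n)%N by lia.
have rn1 : (r < n.+1)%N by nia.
by exists (Ordinal rn1); apply/eqP.
Qed.

Lemma sum_delta_s n (F : nat -> int) :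
  \sum_(1 <= k < n) (-1) ^+ k * (delta_s k)%:Z * F k =
  \sum_(0 <= j < n | (0 < j * j < n)%N) (-1) ^+ j * F (j * j)%N.
Proof.
transitivity (\sum_(1 <= k < n | [exists m : 'I_k.+1, (m * m)%N == k]) (-1) ^+ k * F k).
  rewrite [RHS]big_mkcond; apply: eq_bigr => k _.
  by rewrite /delta_s; case: [exists _, _]; rewrite ?mulr1 ?mulr0 ?mul0r.
rewrite (@sum_image (fun j => j * j)%N) => [|i j ij|[|j]] //.
- apply: eq_bigr => j _; congr (_ * _).
  (* [j^2] and [j] have the same parity. *)
  by rewrite -[LHS]signr_odd oddM andbb signr_odd.
- by apply/eqP; rewrite -eqn_sqr -!mulnn ij.
- by rewrite leq_pmulr.
Qed.

Lemma sum_slice_even n :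
  \sum_(1 <= x < (4 * n).+1) slice (4 * n) (4 * n) x =
  (-1) ^+ n * \sum_(0 <= j < n | (0 < j * j < n)%N)
                (-1) ^+ j * sigma_odd_cofactor (n - j * j).
Proof.
rewrite (bigID (fun x => ~~ odd x && (x * x < 4 * n)%N)) /= [X in _ + X]big1 ?addr0.
  rewrite mulr_sumr (@big_seq_reindex _ _ _ _ _ (index_iota 0 n) _
    (fun j => 0 < j * j < n)%N _ double half) ?iota_uniq //.
  - apply: eq_bigr => j /andP[_ jn].
    by rewrite slice_double // jn exprD mulrA.
  - move=> j; rewrite !mem_index_iota => _ jn; rewrite odd_double doubleK -!muln2.
    by split=> //; nia.
  - move=> x; rewrite !mem_index_iota => /andP[x0 _] /andP[ox xn].
    have xE : x./2.*2 = x by lia.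
    move: x0 xn xE; rewrite -muln2; move: (x./2) => y x0 xn xE.
    by rewrite xE; split=> //; nia.
(* The discarded slices vanish: [x] is odd, or [x = 2 j] with [j^2 >= n]. *)
move=> x; case: (boolP (odd x)) => [ox _|ox]; first by rewrite slice_odd0.
have -> : x = x./2.*2 by lia.
rewrite slice_double // /= -leqNgt => xn.
by case: ifP => //; move: xn; rewrite -!muln2; lia.
Qed.

Lemma square_identity (n : nat) : (0 < n)%N ->
  (sigma n)%:Z + (sigma_o n)%:Z
  + 2 * \sum_(1 <= k < n) (-1) ^+ k * (delta_s k)%:Z
          * ((sigma (n - k))%:Z + (sigma_o (n - k))%:Z)
  = 2 * (-1) ^+ n.+1 * n%:Z * (delta_s n)%:Z.
Proof.
move=> n0; have := rep_sum_slice (leqnn (4 * n)).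
rewrite rep_sum_delta_s sum_slice_even (@slice_double n _ 0) // n0 subn0 addn0.
rewrite (sum_delta_s n (fun k => (sigma (n - k))%:Z + (sigma_o (n - k))%:Z)).
set U : int := \sum_(_ <= _ < _ | _) _; set V : int := \sum_(_ <= _ < _ | _) _ => E.
have -> : V = 2 * U.
  rewrite /V /U mulr_sumr; apply: eq_bigr => j /andP[_ jn].
  by rewrite -sigma_odd_cofactorE ?subn_gt0 // mulrCA.
rewrite -sigma_odd_cofactorE //.
(* The sliced sum carries a factor [(-1)^n]; inserting its square, which is 1, matches the two
   sides. *)
rewrite -[LHS](signrMK n) exprS; move: ((-1) ^+ n) E => e E.
transitivity (e * (2 * (e * sigma_odd_cofactor n + 2 * (e * U)))); first by ring.
by rewrite -E; ring.
Qed.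

(** * Triangular numbers: the case [N = 8 n + 1] *)

Lemma slice_even0 (n B x : nat) : ~~ odd x -> slice (8 * n).+1 B x = 0.
Proof.
move=> ox; apply: big1 => d _; apply: big_pred0 => e.
apply: contraNF ox => /andP[/eqP xE _].
have : odd (x * x) by lia.
by rewrite oddM andbb => ->.
Qed.

Lemma tri_double j : ((j * j.+1) %/ 2).*2 = (j * j.+1)%N.
Proof. by rewrite -muln2 divnK // dvdn2 oddM /= andbN. Qed.

(** For [x = 2 j + 1] and [t = j (j + 1) / 2] one has [x^2 = 8 t + 1], so [d e = 2 (n - t)] with [e]
    even. Such [d] are exactly the divisors of [n - t]. *)
Lemma slice_double_succ (n B j : nat) : (8 * n < B)%N ->
  slice (8 * n).+1 B j.*2.+1 =
  if ((j * j.+1) %/ 2 < n)%N then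
    - ((sigma_o (n - (j * j.+1) %/ 2))%:Z - (sigma_e (n - (j * j.+1) %/ 2))%:Z)
  else 0.
Proof.
move=> nB; have := tri_double j; rewrite -muln2; move: (_ %/ 2)%N => t tE.
case: ifPn => [jn|njn]; last first.
  rewrite /slice big_nat big1 // => d /andP[d0 _].
  rewrite big_nat_cond big_pred0 // => e.
  apply: contraNF njn => /andP[/andP[e0 _] /andP[/eqP E _]].
  have : (0 < d * e)%N by rewrite muln_gt0 d0.
  by move: E; rewrite -!muln2; lia.
have mB : (0 < 2 * (n - t) <= B)%N by lia.
have mB' : (0 < n - t <= B)%N by lia.
transitivity (\sum_(d <- divisors (2 * (n - t)) | ~~ odd ((2 * (n - t)) %/ d))
                (-1) ^+ d * d%:Z).
  rewrite -(sum_factorizations (fun e => ~~ odd e) _ mB).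
  apply: eq_bigr => d _; apply: eq_bigl => e.
  by rewrite /= oddD odd_double /= -!muln2; congr (_ && _); lia.
have -> : (sigma_o (n - t))%:Z - (sigma_e (n - t))%:Z =
    - \sum_(d <- divisors (n - t)) (-1) ^+ d * d%:Z.
  rewrite /sigma_o /sigma_e -[X in X - _]natz -[X in _ - X]natz !natr_sum.
  rewrite [X in _ = - X](bigID odd) /= opprD -!sumrN; congr (_ + _); apply: eq_bigr => d od.
    by rewrite natz -signr_odd od mulN1r opprK.
  by rewrite natz -signr_odd (negPf od) mul1r.
rewrite opprK (big_divisors _ _ mB) (big_divisors _ _ mB').
rewrite big_seq_cond [RHS]big_seq_cond; apply: eq_bigl => d.
rewrite mem_index_iota andbT; case: (boolP (0 < d < B.+1)%N) => //= /andP[d0 _].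
apply/andP/idP => [[/dvdnP[k kE]]|/dvdnP[k kE]].
  rewrite kE mulnK // -dvdn2 => /dvdnP[l lE]; apply/dvdnP; exists l.
  by move: kE; rewrite lE; lia.
by rewrite kE mulnA mulnK // dvdn_mull // oddM.
Qed.

(** [8 n + 1 = (2 r + 1)^2] means [n = r (r + 1) / 2], and then the sum is [-r (r + 1) = -2 n]. *)
Lemma rep_sum_delta_t n :
  rep_sum (8 * n).+1 (8 * n).+1 odd_xe signed_d = - (2 * n%:Z * (delta_t n)%:Z).
Proof.
rewrite /delta_t; case: existsP => [[m /eqP mn]|nm].
  have := tri_double m; rewrite mn -muln2 => tE.
  rewrite mulr1 (@rep_sum_odd_square _ _ (leqnn _) m); last by rewrite -!muln2; lia.
  lia.
rewrite mulr0 oppr0 rep_sum_eq0 // => s sn; apply: nm.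
have os : odd s by rewrite -[odd s]andbb -oddM -sn; lia.
have sE : s = s./2.*2.+1 by lia.
move: sn; rewrite sE -muln2; move: (s./2) => r sn.
have rn : (r * r.+1 = n * 2)%N by lia.
have rn1 : (r < n.+1)%N by nia.
by exists (Ordinal rn1); rewrite /= rn mulnK.
Qed.

Lemma sum_delta_t n (F : nat -> int) :
  \sum_(0 <= k < n) F k * (delta_t k)%:Z =
  \sum_(0 <= j < n | ((j * j.+1) %/ 2 < n)%N) F ((j * j.+1) %/ 2)%N.
Proof.
transitivity (\sum_(0 <= k < n | [exists m : 'I_k.+1, (m * m.+1) %/ 2 == k]%N) F k).
  rewrite [RHS]big_mkcond; apply: eq_bigr => k _.
  by rewrite /delta_t; case: [exists _, _]; rewrite ?mulr1 ?mulr0.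
rewrite (@sum_image (fun j => (j * j.+1) %/ 2)%N) // => [i j ij|j].
  have := tri_double i; rewrite ij tri_double; nia.
have := tri_double j; rewrite -muln2; nia.
Qed.

Lemma sum_slice_odd n :
  \sum_(1 <= x < (8 * n).+2) slice (8 * n).+1 (8 * n).+1 x =
  - \sum_(0 <= j < n | ((j * j.+1) %/ 2 < n)%N)
      ((sigma_o (n - (j * j.+1) %/ 2))%:Z - (sigma_e (n - (j * j.+1) %/ 2))%:Z).
Proof.
rewrite (bigID (fun x => odd x && (x * x < (8 * n).+1)%N)) /= [X in _ + X]big1 ?addr0.
  rewrite -[RHS]sumrN (@big_seq_reindex _ _ _ _ _ (index_iota 0 n) _
    (fun j => (j * j.+1) %/ 2 < n)%N _ (fun j => j.*2.+1) half) ?iota_uniq //.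
  - by apply: eq_bigr => j jn; rewrite slice_double_succ // jn.
  - move=> j; rewrite !mem_index_iota /= => _ jn; rewrite odd_double uphalf_double.
    by have := tri_double j; rewrite -!muln2; split=> //; nia.
  - move=> x; rewrite !mem_index_iota => /andP[x0 _] /andP[ox xn].
    have xE : x./2.*2.+1 = x by lia.
    have := tri_double x./2; rewrite -!muln2.
    move: x0 xn xE; rewrite -!muln2; move: (x./2) => y x0 xn xE tE; rewrite xE.
    have tn : ((y * y.+1) %/ 2 < n)%N by move: xn; rewrite -xE; lia.
    by split=> //; case: y {x0 xn xE} tE tn => [|y]; nia.
move=> x; case: (boolP (odd x)) => [ox|ox _]; last by rewrite slice_even0.
have -> : x = x./2.*2.+1 by lia.
rewrite slice_double_succ // /= -leqNgt => xn.
by case: ifP => //; have := tri_double x./2; move: xn; rewrite -!muln2; lia.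
Qed.

Lemma triangular_identity (n : nat) :
  \sum_(1 <= k < n.+1) ((sigma_o k)%:Z - (sigma_e k)%:Z) * (delta_t (n - k))%:Z
  = n%:Z * (delta_t n)%:Z.
Proof.
have := rep_sum_slice (leqnn (8 * n).+1).
rewrite rep_sum_delta_t sum_slice_odd slice_even0 // add0r.
rewrite -(sum_delta_t n (fun k => (sigma_o (n - k))%:Z - (sigma_e (n - k))%:Z)).
set U : int := \sum_(_ <= _ < _) _; set V : int := \sum_(_ <= _ < _) _ => E.
have -> : V = U; last by move: U V E => U V; lia.
(* Reversal replaces [k] by [n + 1 - k], and the shift to start at 0 makes this [n - k]. *)
rewrite /V /U big_nat_rev big_add1 /=; apply: eq_big_nat => k /andP[_ kn].
by congr (((sigma_o _)%:Z - (sigma_e _)%:Z) * (delta_t _)%:Z); lia.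
Qed.

Theorem theorem5 :
  (forall n : nat, (0 < n)%N ->
     (sigma n)%:Z + (sigma_o n)%:Z
     + 2 * \sum_(1 <= k < n) (-1) ^+ k * (delta_s k)%:Z
             * ((sigma (n - k))%:Z + (sigma_o (n - k))%:Z)
     = 2 * (-1) ^+ n.+1 * n%:Z * (delta_s n)%:Z)
  /\
  (forall n : nat, (0 < n)%N ->
     \sum_(1 <= k < n.+1) ((sigma_o k)%:Z - (sigma_e k)%:Z) * (delta_t (n - k))%:Z
     = n%:Z * (delta_t n)%:Z)
  /\
  (forall n : nat, (1 < n)%N ->
     (sigma n)%:Z + sigma_s n
     + 2 * \sum_(1 <= k < n) (-1) ^+ k * (delta_s k)%:Z
             * ((sigma (n - k))%:Z + sigma_s (n - k))
     = 2 * (-1) ^+ n.+1 * n%:Z * (delta_s n)%:Z).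
Proof.
split; first exact: square_identity.
split=> [n _|n n1]; first exact: triangular_identity.
rewrite -square_identity ?sigma_s_odd ?(ltnW n1) //; congr (_ + 2 * _).
by apply: eq_big_nat => k /andP[_ kn]; rewrite sigma_s_odd // subn_gt0.
Qed.
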